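(* Let $m\ge 1$ and let $\mathfrak{D}_m(\mathbb{C})$ be the $(2m+2)$-dimensional complex general Diamond Lie algebra with basis $\{J,P_1^+,\dots,P_m^+,Q_1^-,\dots,Q_m^-,T\}$. Then a minimal faithful representation of $\mathfrak{D}_m(\mathbb{C})$ is given by the linear map into $(m+2)\times(m+2)$ complex matrices $$\theta J+\sum_{k=1}^m\alpha_kP_k^{+}+\sum_{k=1}^m\beta_kQ_k^{-}+\delta T\ \mapsto\ \begin{pmatrix} \frac{im}{m+2}\theta&\alpha_m&\alpha_{m-1}&\dots&\alpha_2&\alpha_1&-\frac{i}{2}\delta\\ 0&-\frac{2i}{m+2}\theta&0&\dots&0&0&\beta_{m}\\ 0&0&-\frac{2i}{m+2}\theta&\dots&0&0&\beta_{m-1}\\ \vdots&\vdots&\vdots&\ddots&\vdots&\vdots&\vdots\\ 0&0&0&\dots&-\frac{2i}{m+2}\theta&0&\beta_2\\ 0&0&0&\dots&0&-\frac{2i}{m+2}\theta&\beta_1\\ 0&0&0&\dots&0&0&\frac{im}{m+2}\theta \end{pmatrix}$$ for $\theta,\alpha_k,\beta_k,\delta\in\mathbb{C}$. That is, this map is an injective Lie algebra homomorphism (for the matrix commutator $[A,B]=AB-BA$), and every faithful finite-dimensional complex representation of $\mathfrak{D}_m(\mathbb{C})$ has dimension at least $m+2$.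
   Context: $\mathfrak{D}_m(\mathbb{C})$ is the complex Lie algebra with basis $\{J,P_1^+,\dots,P_m^+,Q_1^-,\dots,Q_m^-,T\}$ whose nonzero brackets of basis elements are, up to antisymmetry, $$[J,P_k^{+}]=iP_k^{+},\qquad [J,Q_k^{-}]=-iQ_k^{-},\qquad [P_k^{+},Q_k^{-}]=2iT,\qquad 1\le k\le m,$$ where $i$ is the imaginary unit. In terms of matrix units $e_{p,q}$, the map of the claim sends $J\mapsto \frac{im}{m+2}e_{1,1}-\sum_{s=2}^{m+1}\frac{2i}{m+2}e_{s,s}+\frac{im}{m+2}e_{m+2,m+2}$, $T\mapsto -\frac{i}{2}e_{1,m+2}$, $P_k^+\mapsto e_{1,m+2-k}$, $Q_k^-\mapsto e_{m+2-k,m+2}$. A minimal faithful representation is a faithful representation of least possible dimension. *)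

(* Defs.v *)
From HB Require Import structures.
From mathcomp Require Import all_boot all_order all_algebra.
From mathcomp Require Import ring.
From mathcomp Require Export reals.
From mathcomp Require Export complex.

Set Implicit Arguments.
Unset Strict Implicit.
Unset Printing Implicit Defensive.

Import GRing.Theory Num.Theory.
Local Open Scope ring_scope.

Reserved Notation "⁅ x , y ⁆" (at level 0, x, y at level 99,
  format "⁅ x ,  y ⁆").

HB.mixin Record Lmodule_isLieAlgebra (K : fieldType) L of GRing.Lmodule K L := {
  lie : L -> L -> L;
  lie_linearl : forall z, linear (lie ^~ z);
  lie_linearr : forall z, linear (lie z);
  lie_alt : forall x, lie x x = 0;
  lie_jacobi : forall x y z,
    lie x (lie y z) + lie y (lie z x) + lie z (lie x y) = 0
}.

#[short(type="lieAlgType")]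
HB.structure Definition LieAlgebra (K : fieldType) :=
  {L of GRing.Lmodule K L & Lmodule_isLieAlgebra K L}.

Notation "⁅ x , y ⁆" := (lie x y) : ring_scope.

Definition lie_hom (K : fieldType) (L1 L2 : lieAlgType K) (f : L1 -> L2) : Prop :=
  linear f /\ {morph f : x y / ⁅x, y⁆}.

Lemma commutator_jacobi (V : zmodType) (p q r s t u : V) :
  (p - q - (r - s)) + (r - t - (u - q)) + (u - s - (p - t)) = 0.
Proof.
have E (a b c d : V) : a - b - (c - d) = (a + d) - (b + c).
  by rewrite opprB addrACA -opprD.
rewrite !E [r + q]addrC [u + t]addrC [s + p]addrC.
by rewrite !subrKA subrr.
Qed.

Section MatrixLie.
Variables (K : fieldType) (n : nat).
Implicit Types A B C : 'M[K]_n.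

Definition mx_lie A B := A *m B - B *m A.

Lemma mx_lie_linearl C : linear (mx_lie ^~ C).
Proof.
move=> a A B; rewrite /mx_lie mulmxDl mulmxDr -scalemxAl -scalemxAr.
by rewrite scalerBr opprD addrACA.
Qed.

Lemma mx_lie_linearr C : linear (mx_lie C).
Proof.
move=> a A B; rewrite /mx_lie mulmxDl mulmxDr -scalemxAl -scalemxAr.
by rewrite scalerBr opprD addrACA.
Qed.

Lemma mx_lie_alt A : mx_lie A A = 0.
Proof. exact: subrr. Qed.

Lemma mx_lie_jacobi A B C :
  mx_lie A (mx_lie B C) + mx_lie B (mx_lie C A) + mx_lie C (mx_lie A B) = 0.
Proof.
by rewrite /mx_lie !mulmxBr !mulmxBl !mulmxA; exact: commutator_jacobi.
Qed.

HB.instance Definition _ := Lmodule_isLieAlgebra.Build K 'M[K]_n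
  mx_lie_linearl mx_lie_linearr mx_lie_alt mx_lie_jacobi.
End MatrixLie.

Section EndLie.
Variables (K : fieldType) (V : vectType K).
Implicit Types f g h : 'End(V).

Definition end_lie f g : 'End(V) := (f \o g)%VF - (g \o f)%VF.

Lemma end_lie_linearl h : linear (end_lie ^~ h).
Proof.
move=> a f g; rewrite /end_lie comp_lfunDl comp_lfunDr -comp_lfunZl -comp_lfunZr.
by rewrite scalerBr opprD addrACA.
Qed.

Lemma end_lie_linearr h : linear (end_lie h).
Proof.
move=> a f g; rewrite /end_lie comp_lfunDl comp_lfunDr -comp_lfunZl -comp_lfunZr.
by rewrite scalerBr opprD addrACA.
Qed.

Lemma end_lie_alt f : end_lie f f = 0.
Proof. exact: subrr. Qed.

Lemma end_lie_jacobi f g h :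
  end_lie f (end_lie g h) + end_lie g (end_lie h f) + end_lie h (end_lie f g)
  = 0.
Proof.
rewrite /end_lie !comp_lfunDl !comp_lfunDr !comp_lfunNl !comp_lfunNr !comp_lfunA.
exact: commutator_jacobi.
Qed.

HB.instance Definition _ := Lmodule_isLieAlgebra.Build K 'End(V)
  end_lie_linearl end_lie_linearr end_lie_alt end_lie_jacobi.
End EndLie.

(* GenP k and GenQ k, with k : 'I_m, stand for P_{k+1}^+ and Q_{k+1}^-. *)
Inductive diamond_gen (m : nat) :=
  GenJ | GenP of 'I_m | GenQ of 'I_m | GenT.

Arguments GenJ {m}.
Arguments GenT {m}.

Section DiamondGen.
Variable m : nat.

Definition gen_code (a : diamond_gen m) : (unit + 'I_m) + ('I_m + unit) :=
  match a with
  | GenJ => inl (inl tt) | GenP k => inl (inr k)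
  | GenQ k => inr (inl k) | GenT => inr (inr tt)
  end.

Definition gen_decode (c : (unit + 'I_m) + ('I_m + unit)) : diamond_gen m :=
  match c with
  | inl (inl _) => GenJ | inl (inr k) => GenP k
  | inr (inl k) => GenQ k | inr (inr _) => GenT
  end.

Lemma gen_codeK : cancel gen_code gen_decode. Proof. by case. Qed.
Lemma gen_decodeK : cancel gen_decode gen_code.
Proof. by case=> [[[]|?]|[?|[]]]. Qed.

HB.instance Definition _ := Finite.copy (diamond_gen m) (can_type gen_codeK).

Lemma big_gen (V : nmodType) (F : diamond_gen m -> V) :
  \sum_a F a =
  F GenJ + \sum_(k < m) F (GenP k) + (\sum_(k < m) F (GenQ k) + F GenT).
Proof.
rewrite (reindex gen_decode) /=; last first.
  by exists gen_code => ? _; rewrite ?gen_codeK ?gen_decodeK.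
have unit1 (G : unit -> V) : \sum_u G u = G tt.
  by rewrite (bigD1 tt) //= big1 ?addr0 // => -[].
by rewrite !big_sumType /= !unit1.
Qed.

Lemma card_diamond_gen : #|{: diamond_gen m}| = (2 * m + 2)%N.
Proof.
rewrite -sum1_card big_gen !sum1_card card_ord.
rewrite [LHS](_ : _ = (1 + m + (m + 1))%N) //.
by rewrite [(m + 1)%N]addnC addnACA [(m + m)%N]addnn mul2n addnC.
Qed.

End DiamondGen.

Definition diamond (C : numClosedFieldType) (m : nat) : Type :=
  {ffun diamond_gen m -> C^o}.

HB.instance Definition _ (C : numClosedFieldType) (m : nat) :=
  GRing.Lmodule.copy (diamond C m) {ffun diamond_gen m -> C^o}.

Section DiamondLie.
Variables (C : numClosedFieldType) (m : nat).
Implicit Types (x y z : diamond C m) (a b c : diamond_gen m).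

Definition diamond_basis a : diamond C m := [ffun b => (b == a)%:R].

Lemma diamondZE (k : C) x a : (k *: x) a = k * x a :> C.
Proof. by rewrite ffunE. Qed.

Lemma diamondDE x y a : (x + y) a = x a + y a :> C.
Proof. by rewrite ffunE. Qed.

Lemma diamondNE x a : (- x) a = - x a :> C.
Proof. by rewrite ffunE. Qed.

Lemma diamond_basisE a b : diamond_basis a b = (b == a)%:R :> C.
Proof. by rewrite ffunE. Qed.

Definition diamondE := (diamondZE, diamondDE, diamondNE, diamond_basisE).

Lemma diamond_basisP x : x = \sum_a (x a : C) *: diamond_basis a.
Proof.
apply/ffunP => b; rewrite sum_ffunE (bigD1 b) //= big1 ?addr0; last first.
  by move=> a neq; rewrite !diamondE eq_sym (negPf neq) mulr0.
by rewrite !diamondE eqxx mulr1.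
Qed.

Definition diamond_table a b : diamond C m :=
  match a, b with
  | GenJ, GenP k => 'i *: diamond_basis (GenP k)
  | GenJ, GenQ k => - 'i *: diamond_basis (GenQ k)
  | GenP k, GenQ l => if k == l then 2 * 'i *: diamond_basis GenT else 0
  | _, _ => 0
  end.

Definition diamond_table_ext x y : diamond C m :=
  \sum_a \sum_b (x a * y b : C) *: diamond_table a b.

(* The table lists each nonzero bracket in one order only, so antisymmetrizing
   its bilinear extension produces no factor 2; see lie_diamond_basis. *)
Definition diamond_lie x y := diamond_table_ext x y - diamond_table_ext y x.

Lemma table_ext_linearl z : linear (diamond_table_ext ^~ z).
Proof.
move=> k x y; rewrite /diamond_table_ext scaler_sumr -big_split.
apply: eq_bigr => a _; rewrite scaler_sumr -big_split.
by apply: eq_bigr => b _; rewrite !diamondE mulrDl scalerDl scalerA mulrA.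
Qed.

Lemma table_ext_linearr z : linear (diamond_table_ext z).
Proof.
move=> k x y; rewrite /diamond_table_ext scaler_sumr -big_split.
apply: eq_bigr => a _; rewrite scaler_sumr -big_split.
by apply: eq_bigr => b _; rewrite !diamondE mulrDr scalerDl scalerA mulrCA.
Qed.

Lemma table_ext_basis a b :
  diamond_table_ext (diamond_basis a) (diamond_basis b) = diamond_table a b.
Proof.
rewrite /diamond_table_ext (bigD1 a) //= (bigD1 b) //=.
rewrite [X in _ + X + _]big1 ?addr0; last first.
  by move=> b' /negPf n; rewrite !diamondE n mulr0 scale0r.
rewrite big1 ?addr0; last first.
  move=> a' /negPf n; apply: big1 => b' _.
  by rewrite !diamondE n mul0r scale0r.
by rewrite !diamondE !eqxx mulr1 scale1r.
Qed.

Lemma diamond_lie_linearl z : linear (diamond_lie ^~ z).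
Proof.
move=> k x y; rewrite /diamond_lie table_ext_linearl table_ext_linearr.
by rewrite scalerBr opprD addrACA.
Qed.

Lemma diamond_lie_linearr z : linear (diamond_lie z).
Proof.
move=> k x y; rewrite /diamond_lie table_ext_linearl table_ext_linearr.
by rewrite scalerBr opprD addrACA.
Qed.

Lemma diamond_lie_alt x : diamond_lie x x = 0.
Proof. exact: subrr. Qed.

Lemma table_extE x y : diamond_table_ext x y =
  \sum_k (x GenJ * y (GenP k) * 'i : C) *: diamond_basis (GenP k)
  + \sum_k (x GenJ * y (GenQ k) * - 'i : C) *: diamond_basis (GenQ k)
  + (\sum_k x (GenP k) * y (GenQ k) * (2 * 'i) : C) *: diamond_basis GenT.
Proof.
have zero (I : finType) (F : I -> C) : \sum_k F k *: (0 : diamond C m) = 0.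
  by apply: big1 => k _; rewrite scaler0.
rewrite /diamond_table_ext big_gen /= big_gen /= !zero !scaler0 add0r !addr0.
rewrite [X in _ + _ + X]big1 ?addr0; last by move=> k _; exact: zero.
congr (_ + _ + _).
- by apply: eq_bigr => k _; rewrite scalerA.
- by apply: eq_bigr => k _; rewrite scalerA.
rewrite scaler_suml; apply: eq_bigr => k _.
rewrite big_gen /= !zero !scaler0 !add0r addr0.
rewrite (bigD1 k) //= eqxx scalerA big1 ?addr0 // => l /negPf n.
by rewrite eq_sym n scaler0.
Qed.

Lemma table_ext_coord x y a : diamond_table_ext x y a =
  match a with
  | GenJ => 0
  | GenP k => x GenJ * y (GenP k) * 'i
  | GenQ k => x GenJ * y (GenQ k) * - 'i
  | GenT => \sum_k x (GenP k) * y (GenQ k) * (2 * 'i)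
  end :> C.
Proof.
have P1 (F : 'I_m -> C) (g : 'I_m -> diamond_gen m) k : injective g ->
    (\sum_k F k *: diamond_basis (g k)) (g k) = F k.
  move=> gI; rewrite sum_ffunE (bigD1 k) //= big1 ?addr0; last first.
    by move=> l /negPf n; rewrite !diamondE (inj_eq gI) eq_sym n mulr0.
  by rewrite !diamondE eqxx mulr1.
have P0 (F : 'I_m -> C) (g : 'I_m -> diamond_gen m) b :
    (forall k, b != g k) -> (\sum_k F k *: diamond_basis (g k)) b = 0.
  move=> n; rewrite sum_ffunE big1 // => k _.
  by rewrite !diamondE (negPf (n k)) mulr0.
have Z (c : C) b : b != GenT -> (c *: diamond_basis GenT) b = 0.
  by move=> n; rewrite !diamondE (negPf n) mulr0.
rewrite table_extE.
case: a => [|k|k|]; rewrite !diamondDE.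
- by rewrite !P0 ?Z ?addr0.
- by rewrite (P1 _ (@GenP m)) ?P0 ?Z ?addr0 // => ? ? [].
- by rewrite (P1 _ (@GenQ m)) ?P0 ?Z ?addr0 ?add0r // => ? ? [].
by rewrite !P0 // !add0r !diamondE eqxx mulr1.
Qed.

Lemma diamond_lie_jacobi x y z :
  diamond_lie x (diamond_lie y z) + diamond_lie y (diamond_lie z x)
  + diamond_lie z (diamond_lie x y) = 0.
Proof.
have c u v a : diamond_lie u v a =
    diamond_table_ext u v a - diamond_table_ext v u a :> C.
  by rewrite !diamondE.
apply/ffunP => a; rewrite !diamondE [RHS]ffunE !table_ext_coord.
case: a => [|k|k|].
- by rewrite subrr !addr0.
- by rewrite !c !table_ext_coord; ring.
- by rewrite !c !table_ext_coord; ring.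
rewrite -!sumrB -!big_split /=; apply: big1 => k _.
by rewrite !c !table_ext_coord; ring.
Qed.

HB.instance Definition _ := Lmodule_isLieAlgebra.Build C (diamond C m)
  diamond_lie_linearl diamond_lie_linearr diamond_lie_alt diamond_lie_jacobi.

Lemma lie_diamond_basis a b :
  ⁅diamond_basis a, diamond_basis b⁆ = diamond_table a b - diamond_table b a.
Proof. by rewrite /lie /= /diamond_lie !table_ext_basis. Qed.

End DiamondLie.

(* Over C = R[i], the imaginary unit 'i of a numClosedFieldType is 0 +i* 1.
   Block sizes 1, m, 1; the reversed indices give the decreasing order
   alpha_m, ..., alpha_1 of the first row, and likewise for the last column. *)
Definition diamond_mx (C : numClosedFieldType) (m : nat) (x : diamond C m) :
    'M[C]_(1 + (m + 1)) :=
  let theta : C := x GenJ in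
  let alpha k : C := x (GenP k) in
  let beta k : C := x (GenQ k) in
  let delta : C := x GenT in
  block_mx
    ('i * m%:R / (m + 2)%:R * theta)%:M
    (row_mx (\row_k alpha (rev_ord k)) (- ('i / 2) * delta)%:M)
    0
    (block_mx
       (- (2 * 'i / (m + 2)%:R) * theta)%:M  (\col_k beta (rev_ord k))
       0                                      ('i * m%:R / (m + 2)%:R * theta)%:M).

(* Main.v *)
Require Import Defs.
From HB Require Import structures.
From mathcomp Require Import all_boot all_order all_algebra.
From mathcomp Require Import ring zify.

(** The map is a Lie algebra morphism by block multiplication: the commutator of
two matrices of the displayed shape is again strictly above the block diagonal,
its corner entry is the symplectic form of the pairs (alpha, beta), and J acts
by the difference of the two diagonal scalars, which is i
([commutator_strip], [diamond_mx_lie]). Injectivity is read off the entries;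
the coefficient im/(m+2) of theta is nonzero because m > 0.

For the lower bound, let T be the nonzero image of the central element in a
representation of dimension n; vectors are rows and matrices act on the right.
Since T commutes with J, some nonzero u = vT in the image of T is an eigenvector
of J, of eigenvalue lam say ([eigenvector_in_stable_subspace]).  The orbit space
S spanned by vT and all vP_k, vQ_k has dimension at least m + 1: the
combinations X of the P_k, Q_k with vX in the line of vT form an isotropic
subspace for the symplectic form [X, Y] / T, so they have dimension at most m
out of 2m, and vT adds one more ([heisenberg_orbit_rank]).

It remains to see that v is not in S, for then n >= m + 2.  If
v = vP + vQ + c vT with P, Q in the spans of the P_k and of the Q_k, applying T
gives u = uP + uQ + c uT.  Here u and uT have J-eigenvalue lam, while uP and uQ
have eigenvalues lam + i and lam - i, so uP + uQ = 0 ([eigen_split_eq0]) and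
u = c uT.  Thus T has the nonzero eigenvalue 1/c, which is impossible because T
is up to a scalar a commutator of matrices commuting with it: on the eigenspace
of T the trace of that commutator would be nonzero
([commutator_eigenvalue0]). *)

Set Implicit Arguments.
Unset Strict Implicit.
Unset Printing Implicit Defensive.

Import GRing.Theory Num.Theory.
Import passmx.
Local Open Scope ring_scope.

(** * Eigenvectors *)

(** The preimage v is kept in the conclusion because the dimension count is made
on the orbit of v, whereas only vU is known to be an eigenvector. *)
Lemma eigenvector_in_stable_subspace (C : numClosedFieldType) n
    (A U : 'M[C]_n) :
  U != 0 -> stablemx U A ->
  exists2 v : 'rV_n, v *m U != 0 & exists lam, v *m U *m A = lam *: (v *m U).
Proof.
move=> U0 UA.
have r0 : (0 < \rank U)%N by rewrite lt0n mxrank_eq0.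
have [lam /eigenvalueP[w wA w0]] := eigenvalue_closed (restrictmx U A) r0.
have wU : w *m row_base U != 0 by rewrite mulmx_free_eq0 ?row_base_free.
have /submxP[v vU] : (w *m row_base U <= U)%MS.
  by rewrite (submx_trans (submxMl _ _)) // eq_row_base.
exists v; first by rewrite -vU.
exists lam; rewrite -vU scalemxAl -wA -[LHS]mulmxA -[RHS]mulmxA; congr (_ *m _).
by rewrite mulmxKpV // (eqmx_stable _ (eq_row_base U)).
Qed.

(** Subtracting the eigenvalue equations gives e (p - q) = 0, so that p = q is an
eigenvector for both lam + e and lam - e, and 2e is nonzero. *)
Lemma eigen_split_eq0 (F : numFieldType) n (A : 'M[F]_n) (lam e : F)
    (p q : 'rV_n) :
  e != 0 -> p *m A = (lam + e) *: p -> q *m A = (lam - e) *: q ->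
  (p + q) *m A = lam *: (p + q) -> p + q = 0.
Proof.
move=> e0 pA qA; rewrite mulmxDl pA qA => H.
have pq : p = q.
  apply/eqP; rewrite -subr_eq0 -(inj_eq (scalerI e0)) scaler0 scalerBr.
  move/eqP: H; rewrite -subr_eq0 => /eqP <-; apply/eqP.
  by apply/rowP => i; rewrite !mxE; ring.
have : (e + e) *: p = 0.
  have : (lam + e) *: p - (lam - e) *: p = 0 by rewrite -pA pq -qA subrr.
  by move=> <-; apply/rowP => i; rewrite !mxE; ring.
move/eqP; rewrite -mulr2n scaler_eq0 mulrn_eq0 (negPf e0) => /eqP p0.
by rewrite -pq p0 addr0.
Qed.

(** A and B preserve the mu-eigenspace of T, on which their commutator is the
scalar c mu; its trace is zero, and the characteristic is zero. *)
Lemma commutator_eigenvalue0 (F : numFieldType) n (A B T : 'M[F]_n) (c : F)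
    (u : 'rV_n) (mu : F) :
  c != 0 -> A *m B - B *m A = c *: T -> comm_mx T A -> comm_mx T B ->
  u != 0 -> u *m T = mu *: u -> mu = 0.
Proof.
move=> c0 AB TA TB u0 uT.
pose E := eigenspace T mu; pose W := row_base E.
have r0 : \rank E != 0%N.
  rewrite mxrank_eq0; apply: contraNneq u0 => E0.
  by rewrite -submx0 -[X in (_ <= X)%MS]E0; exact/eigenspaceP.
have restr (X : 'M_n) : comm_mx T X -> exists X', W *m X = X' *m W.
  move=> TX; apply/submxP.
  rewrite (eqmx_stable _ (eq_row_base E)).
  exact: comm_mx_stable_eigenspace.
have [A' WA] := restr _ TA; have [B' WB] := restr _ TB.
have WT : W *m T = mu *: W by apply/eigenspaceP; rewrite eq_row_base.
have Wfree : row_free W by exact: row_base_free.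
clearbody W.
have : A' *m B' - B' *m A' = (c * mu)%:M.
  apply: (row_free_inj Wfree); rewrite mulmxBl mul_scalar_mx.
  rewrite -!mulmxA -WA -WB !mulmxA -WA -WB -!mulmxA -mulmxBr AB.
  by rewrite -scalemxAr WT scalerA.
move/(congr1 mxtrace); rewrite linearB /= mxtrace_mulC subrr mxtrace_scalar.
move/esym/eqP; rewrite mulrn_eq0 (negPf r0) mulf_eq0 (negPf c0) /=.
by move/eqP.
Qed.

(** * Orbits of Heisenberg algebras *)

(** If two combinations X, Y of the X_i map v into the line of u = vT, say
vX = a u and vY = b u, then v[X, Y] = a uY - b uX = a b uT - b a uT = 0, since T
is central; hence [X, Y] = 0.  So the coefficient vectors of such combinations
form a totally isotropic subspace for the nondegenerate form Om, of dimension at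
most d / 2, and modulo u the vectors v X_i span at least d / 2 dimensions. *)
Lemma heisenberg_orbit_rank (F : fieldType) n d (X : 'I_d -> 'M[F]_n)
    (T : 'M_n) (Om : 'M_d) (v : 'rV_n) :
  Om \in unitmx -> (forall i, comm_mx T (X i)) ->
  (forall i j, X i *m X j - X j *m X i = Om i j *: T) ->
  v *m T != 0 ->
  (d + 2 <= 2 * \rank (\matrix_i (v *m X i) + v *m T)%MS)%N.
Proof.
move=> Omu TX XX u0; set M := \matrix_i _; set u := v *m T.
pose lc (x : 'rV_d) := \sum_i x 0 i *: X i.
have lcM x : v *m lc x = x *m M.
  rewrite [RHS]mulmx_sum_row /lc mulmx_sumr; apply: eq_bigr => i _.
  by rewrite rowK -scalemxAr.
have lcC x y : lc x *m lc y - lc y *m lc x = (x *m Om *m y^T) 0 0 *: T.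
  have mulE z w : lc z *m lc w =
      \sum_i \sum_j (z 0 i * w 0 j) *: (X i *m X j).
    rewrite /lc mulmx_suml; apply: eq_bigr => i _; rewrite mulmx_sumr.
    by apply: eq_bigr => j _; rewrite -scalemxAl -scalemxAr scalerA.
  rewrite !mulE [X in _ - X]exchange_big -sumrB mxE scaler_suml /=.
  under [RHS]eq_bigr do rewrite !mxE mulr_suml scaler_suml.
  rewrite [RHS]exchange_big; apply: eq_bigr => i _; rewrite -sumrB.
  apply: eq_bigr => j _ /=; rewrite [y _ _ * _]mulrC -scalerBr XX scalerA.
  by rewrite mulrAC.
pose K := kermx (M *m cokermx u).
have KP i : exists c, v *m lc (row i K) = c *: u.
  rewrite lcM; apply/sub_rVP; rewrite submxE -mulmxA -row_mul mulmx_ker.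
  by rewrite row0.
have Tlc x : v *m T *m lc x = v *m lc x *m T.
  rewrite -!mulmxA; congr (_ *m _); rewrite /lc mulmx_sumr mulmx_suml.
  by apply: eq_bigr => i _; rewrite -scalemxAl -scalemxAr TX.
have KOmK : K *m Om *m K^T = 0.
  apply/matrixP => i j; rewrite [RHS]mxE.
  have -> : (K *m Om *m K^T) i j = (row i K *m Om *m (row j K)^T) 0 0.
    by rewrite !mxE; apply: eq_bigr => k _; rewrite -row_mul !mxE.
  have [a Ka] := KP i; have [b Kb] := KP j.
  have := congr1 (mulmx v) (lcC (row i K) (row j K)).
  rewrite mulmxBr !mulmxA Ka Kb -!scalemxAl /u !Tlc Ka Kb -!scalemxAl !scalerA.
  rewrite [b * a]mulrC subrr -scalemxAr => /esym/eqP.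
  by rewrite scaler_eq0 (negPf u0) orbF => /eqP.
have := mulmx0_rank_max KOmK.
rewrite mxrankMfree ?row_free_unit // mxrank_tr mxrank_ker.
set r := \rank (M *m _) => rd.
(* The rank r is taken modulo the line of u, which lies in the sum. *)
have r1 : (r < \rank (M + u)%MS)%N.
  rewrite -(mxrank_mul_ker (M + u)%MS (cokermx u)) -addn1 leq_add //.
    by apply/mxrankS/submxMr/addsmxSl.
  suff /mxrankS : (u <= (M + u) :&: kermx (cokermx u))%MS by rewrite rank_rV u0.
  by rewrite sub_capmx addsmxSr; apply/sub_kermxP; rewrite mulmx_coker.
have rled : (r <= d)%N by exact: rank_leq_row.
move: rd r1 rled; clearbody r; lia.
Qed.

(** The brackets of the P k and Q l have the sign of the opposite algebra, as is
natural for matrices acting on the right; the constants c and e absorb it. *)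
Lemma diamond_matrices_dim (C : numClosedFieldType) m n (J T : 'M[C]_n)
    (P Q : 'I_m -> 'M[C]_n) (c e : C) :
  c != 0 -> e != 0 -> (0 < m)%N -> T != 0 ->
  comm_mx T J -> (forall k, comm_mx T (P k)) -> (forall k, comm_mx T (Q k)) ->
  (forall k l, comm_mx (P k) (P l)) -> (forall k l, comm_mx (Q k) (Q l)) ->
  (forall k l, P k *m Q l - Q l *m P k = (c *+ (k == l)) *: T) ->
  (forall k, P k *m J - J *m P k = e *: P k) ->
  (forall k, Q k *m J - J *m Q k = - e *: Q k) ->
  (m + 2 <= n)%N.
Proof.
move=> c0 e0 m0 T0 TJ TP TQ PP QQ PQ PJ QJ.
have [v u0 [lam uJ]] : exists2 v : 'rV_n, v *m T != 0 &
    exists lam, v *m T *m J = lam *: (v *m T).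
  apply: eigenvector_in_stable_subspace => //.
  by rewrite TJ submxMl.
pose X (i : 'I_(m + m)) := match split i with inl k => P k | inr k => Q k end.
have XP k : X (lshift m k) = P k by rewrite /X (unsplitK (inl k)).
have XQ k : X (rshift m k) = Q k by rewrite /X (unsplitK (inr k)).
pose Om : 'M[C]_(m + m) := block_mx 0 c%:M (- c%:M) 0.
have Omu : Om \in unitmx.
  suff /mulmx1_unit[] : Om *m block_mx 0 (- c^-1%:M) c^-1%:M 0 = 1%:M by [].
  rewrite mulmx_block !mul0mx !mulmx0 !add0r !addr0 mulmxN mulNmx opprK.
  by rewrite -!scalar_mxM mulfV // -scalar_mx_block.
have TX i : comm_mx T (X i) by rewrite /X; case: split.
have XX i j : X i *m X j - X j *m X i = Om i j *: T.
  case: (split_ordP i) => k ->; case: (split_ordP j) => l ->;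
    rewrite ?XP ?XQ /Om.
  - by rewrite block_mxEul mxE scale0r PP subrr.
  - by rewrite block_mxEur mxE PQ.
  - by rewrite block_mxEdl !mxE -opprB PQ scaleNr eq_sym.
  - by rewrite block_mxEdr mxE scale0r QQ subrr.
have := heisenberg_orbit_rank Omu TX XX u0.
set M := \matrix_i _; set S := (M + _)%MS.
suff vS : ~~ (v <= S)%MS.
  have : (\rank S < n)%N.
    rewrite ltn_neqAle rank_leq_col andbT; apply: contraNneq vS => Sn.
    by rewrite submx_full // /row_full Sn.
  lia.
apply/negP => /sub_addsmxP[[x y] /= vE].
set u := v *m T in u0 uJ vE *.
pose p := \sum_k x 0 (lshift m k) *: (u *m P k).
pose q := \sum_k x 0 (rshift m k) *: (u *m Q k).
(* Apply T to v = vP + vQ + y vT and move it to the left past P and Q. *)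
have uE : u = p + q + y 0 0 *: (u *m T).
  rewrite {1}/u vE mulmxDl {1}[y]mx11_scalar mul_scalar_mx -scalemxAl.
  congr (_ + _).
  rewrite [x *m M]mulmx_sum_row big_split_ord /= mulmxDl !mulmx_suml.
  congr (_ + _); apply: eq_bigr => k _; rewrite rowK -scalemxAl ?XP ?XQ.
    by rewrite /u -!mulmxA TP.
  by rewrite /u -!mulmxA TQ.
clearbody u.
have weight (Y : 'M_n) d : Y *m J - J *m Y = d *: Y ->
    u *m Y *m J = (lam + d) *: (u *m Y).
  move/eqP; rewrite subr_eq => /eqP YJ.
  by rewrite -mulmxA YJ mulmxDr mulmxA uJ -scalemxAr -scalemxAl addrC scalerDl.
have pJ : p *m J = (lam + e) *: p.
  rewrite mulmx_suml scaler_sumr; apply: eq_bigr => k _.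
  by rewrite -scalemxAl (weight _ _ (PJ k)) !scalerA mulrC.
have qJ : q *m J = (lam - e) *: q.
  rewrite mulmx_suml scaler_sumr; apply: eq_bigr => k _.
  by rewrite -scalemxAl (weight _ _ (QJ k)) !scalerA mulrC.
have pq0 : p + q = 0.
  apply: (eigen_split_eq0 e0 pJ qJ).
  have -> : p + q = u - y 0 0 *: (u *m T) by rewrite [X in X - _]uE addrK.
  rewrite mulmxBl uJ -scalemxAl -mulmxA TJ mulmxA uJ -scalemxAl.
  by rewrite scalerBr !scalerA mulrC.
move: uE; rewrite pq0 add0r => uE.
have y0 : y 0 0 != 0 by apply: contraNneq u0 => y0; rewrite uE y0 scale0r.
have uT : u *m T = (y 0 0)^-1 *: u by rewrite {2}uE scalerA mulVf ?scale1r.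
(* Any single pair P_k, Q_k has a nonzero multiple of T as commutator. *)
pose k := Ordinal m0.
have PQk := PQ k k; rewrite eqxx in PQk.
have := commutator_eigenvalue0 c0 PQk (TP k) (TQ k) u0 uT.
by move/eqP; rewrite invr_eq0 (negPf y0).
Qed.

(** * The matrix representation *)

Lemma diamond_lieE (C : numClosedFieldType) m (x y : diamond C m) a :
  ⁅x, y⁆ a =
  match a with
  | GenJ => 0
  | GenP k => 'i * (x GenJ * y (GenP k) - y GenJ * x (GenP k))
  | GenQ k => - 'i * (x GenJ * y (GenQ k) - y GenJ * x (GenQ k))
  | GenT => 2 * 'i * \sum_k (x (GenP k) * y (GenQ k) - y (GenP k) * x (GenQ k))
  end :> C.
Proof.
rewrite [LHS]diamondDE diamondNE !table_ext_coord.
case: a => [|k|k|]; [by rewrite subrr | by ring | by ring |].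
rewrite -sumrB mulr_sumr; apply: eq_bigr => k _; ring.
Qed.

Lemma diamond_mx_linear (C : numClosedFieldType) m : linear (@diamond_mx C m).
Proof.
move=> a x y; rewrite /diamond_mx !diamondE scale_block_mx add_block_mx.
rewrite scale_row_mx add_row_mx scale_block_mx add_block_mx !scaler0 !addr0.
rewrite !scale_scalar_mx -!raddfD /=.
congr (block_mx _%:M (row_mx _ _%:M) _ (block_mx _%:M _ _ _%:M));
  try by ring.
all: by apply/matrixP => i j; rewrite !mxE !diamondE.
Qed.

Lemma diamond_mx_inj (C : numClosedFieldType) m :
  (0 < m)%N -> injective (@diamond_mx C m).
Proof.
move=> m0 x y /eq_block_mx[J1 /eq_row_mx[P T] _ /eq_block_mx[_ Q _ _]].
have cancel_scalar (k s t : C) n : (0 < n)%N -> k != 0 ->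
    (k * s)%:M = (k * t)%:M :> 'M_n -> s = t.
  case: n => // n _ k0 /matrixP/(_ 0 0); rewrite !mxE eqxx /=.
  exact: mulfI.
apply/ffunP; case=> [|k|k|].
- apply: (cancel_scalar _ _ _ _ (ltn0Sn 0)) J1.
  by rewrite !mulf_neq0 ?invr_eq0 ?neq0Ci ?pnatr_eq0 -?lt0n ?addn2.
- by have /rowP/(_ (rev_ord k)) := P; rewrite !mxE rev_ordK.
- by have /colP/(_ (rev_ord k)) := Q; rewrite !mxE rev_ordK.
apply: (cancel_scalar _ _ _ _ (ltn0Sn 0)) T.
by rewrite oppr_eq0 mulf_neq0 ?invr_eq0 ?neq0Ci ?pnatr_eq0.
Qed.

(** The outer diagonal blocks carry the same scalar a; this is why the corner
entries c and c' drop out, so that T is sent to a central element. *)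
Lemma commutator_strip (K : fieldType) m (a b c a' b' c' : K)
    (p p' : 'rV[K]_m) (q q' : 'cV[K]_m) :
  ⁅block_mx a%:M (row_mx p c%:M) 0 (block_mx b%:M q 0 a%:M),
   block_mx a'%:M (row_mx p' c'%:M) 0 (block_mx b'%:M q' 0 a'%:M)⁆ =
  block_mx 0
    (row_mx ((a - b) *: p' - (a' - b') *: p) (p *m q' - p' *m q)) 0
    (block_mx 0 ((b - a) *: q' - (b' - a') *: q) 0 0)
  :> 'M_(1 + (m + 1)).
Proof.
rewrite /lie /= /mx_lie !mulmx_block !mul_row_block !mulmx0 !mul0mx.
rewrite !addr0 !add0r !opp_block_mx !add_block_mx.
rewrite !mul_scalar_mx !mul_mx_scalar !scale_row_mx !add_row_mx !opp_row_mx.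
rewrite !add_row_mx !oppr0 !add0r !scale_scalar_mx.
congr (block_mx _ (row_mx _ _) _ (block_mx _ _ _ _)).
all: by apply/matrixP => i j; rewrite !mxE; ring.
Qed.

Lemma diamond_mx_lie (C : numClosedFieldType) m :
  {morph @diamond_mx C m : x y / ⁅x, y⁆}.
Proof.
move=> x y; rewrite [RHS]commutator_strip /diamond_mx !diamond_lieE !mulr0.
rewrite !raddf0.
(* The difference of the two diagonal scalars of the image of J. *)
have weight : 'i * m%:R / (m + 2)%:R + 2 * 'i / (m + 2)%:R = 'i :> C.
  by rewrite -mulrDl [2 * _]mulrC -mulrDr -natrD mulfK // pnatr_eq0 addn2.
congr (block_mx _ (row_mx _ _) _ (block_mx _ _ _ _)).
- apply/rowP => k; rewrite !mxE diamond_lieE -{1}weight; ring.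
- apply/matrixP => i j; rewrite !ord1 !mxE eqxx mulr1n.
  rewrite -sumrB (reindex_inj rev_ord_inj) /= mulrA.
  have -> : - ('i / 2) * (2 * 'i) = 1 :> C.
    rewrite mulNr mulrA mulfVK ?pnatr_eq0 //.
    by rewrite -expr2 sqrCi opprK.
  by rewrite mul1r; apply: eq_bigr => k _; rewrite !mxE.
- apply/colP => k; rewrite !mxE diamond_lieE -{1}weight; ring.
Qed.

(** * The lower bound for abstract representations *)

(** Passing to the matrix of an endomorphism acting on row vectors reverses
composition, so brackets turn into opposite commutators. *)
Lemma diamond_rep_dim (C : numClosedFieldType) m (V : vectType C)
    (rho : diamond C m -> 'End(V)) :
  (0 < m)%N -> lie_hom rho -> injective rho -> (m + 2 <= \dim {:V})%N.
Proof.
move=> m0 [rho_lin rho_lie] rho_inj.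
pose f : {linear diamond C m -> 'End(V)} :=
  HB.pack rho (GRing.isLinear.Build _ _ _ _ rho rho_lin).
pose mx x := mxof (vbasis {:V}) (vbasis {:V}) (f x).
have mxB x y : mx y *m mx x - mx x *m mx y = mx ⁅x, y⁆.
  by rewrite /mx [f ⁅x, y⁆]rho_lie linearB /= !(mxof_comp _ _ (vbasisP _)).
have mxZ a x : mx (a *: x) = a *: mx x by rewrite /mx !linearZ.
have mx0 : mx 0 = 0 by rewrite /mx !linear0.
pose g a := mx (diamond_basis C a).
have gB a b : g b *m g a - g a *m g b =
    mx (diamond_table C a b - diamond_table C b a).
  by rewrite mxB lie_diamond_basis.
have gC a b : diamond_table C a b - diamond_table C b a = 0 ->
    comm_mx (g b) (g a).
  by move=> ab0; apply/eqP; rewrite -subr_eq0 gB ab0 mx0.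
apply: (@diamond_matrices_dim C m _ (g GenJ) (g GenT) (fun k => g (GenP k))
  (fun k => g (GenQ k)) (- (2 * 'i)) 'i) => //.
- by rewrite oppr_eq0 mulf_neq0 ?neq0Ci ?pnatr_eq0.
- exact: neq0Ci.
- rewrite mxof_eq0 ?vbasisP //; apply/eqP => T0.
  have /ffunP/(_ GenT) : diamond_basis C (@GenT m) = 0.
    by apply: rho_inj; rewrite [LHS]T0 [RHS](linear0 f).
  by rewrite diamond_basisE ffunE eqxx => /eqP; rewrite oner_eq0.
- by apply: gC; rewrite subrr.
- by move=> k; apply: gC; rewrite subrr.
- by move=> k; apply: gC; rewrite subrr.
- by move=> k l; apply: gC; rewrite subrr.
- by move=> k l; apply: gC; rewrite subrr.
- move=> k l; rewrite gB /= sub0r eq_sym; case: eqP => _.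
    by rewrite -scaleNr mxZ.
  by rewrite oppr0 mx0 scale0r.
- by move=> k; rewrite gB /= subr0 mxZ.
- by move=> k; rewrite gB /= subr0 mxZ.
Qed.

Theorem proposition1 (R : realType) (m : nat) (hm : (1 <= m)%N) :
  [/\ lie_hom (@diamond_mx R[i] m),
      injective (@diamond_mx R[i] m)
    & forall (V : vectType R[i]) (rho : diamond R[i] m -> 'End(V)),
        lie_hom rho -> injective rho -> (m + 2 <= \dim {:V})%N].
Proof.
split; last by move=> V rho; exact: diamond_rep_dim.
  by split; [exact: diamond_mx_linear | exact: diamond_mx_lie].
exact: diamond_mx_inj.
Qed.
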